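(* For every integer $n>1$, \[\overline{pl}(n)\equiv 2\cdot\prod_{p \text{ odd prime},\ p\mid n}\bigl(\mathrm{ord}_p(n)+1\bigr)\pmod 4,\] where the empty product equals $1$.
   Context: A plane overpartition of $n$ is a plane partition of $n$ (an array $(\pi_{ij})_{i,j\geq1}$ of nonnegative integers, weakly decreasing along rows and down columns, with $\sum\pi_{ij}=n$) in which entries may be overlined subject to: in each row, the last occurrence of an integer may be overlined or not and all other occurrences of that integer in the row are not overlined; in each column, the first occurrence of an integer may be overlined or not and all other occurrences of that integer in the column are overlined. $\overline{pl}(n)$ denotes the number of plane overpartitions of $n$; its generating function is $\sum_{n\geq0}\overline{pl}(n)q^n=\prod_{n\geq1}\frac{(1+q^n)^n}{(1-q^n)^n}$. For a prime $p$, $\mathrm{ord}_p(n)$ is the largest nonnegative integer $e$ with $p^e\mid n$. *)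

(* Defs.v *)
From HB Require Import structures.
From mathcomp Require Import all_boot.
From mathcomp Require Import finmap.
From mathcomp Require Import boolp classical_sets functions cardinality.
Set Implicit Arguments.
Unset Strict Implicit.
Unset Printing Implicit Defensive.
Local Open Scope classical_set_scope.

(* Rows and columns are numbered from 0; the entries equal to 0 are the empty
   cells of the array. *)
Definition plane_partition (n : nat) (a : nat -> nat -> nat) : Prop :=
  [/\ forall i j j', j <= j' -> a i j' <= a i j,
      forall i i' j, i <= i' -> a i' j <= a i j &
      exists N, (forall i j, (N <= i) || (N <= j) -> a i j = 0) /\
                \sum_(i < N) \sum_(j < N) a i j = n].

(* [a i j = (v, o)]: the entry is v, and it is overlined iff o.  The
   overlining rules concern the positive integers only; empty cells are never
   overlined. *)
Definition plane_overpartition (n : nat) (a : nat -> nat -> nat * bool) : Prop :=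
  [/\ plane_partition n (fun i j => (a i j).1),
      forall i j, (a i j).1 = 0 -> (a i j).2 = false,
      forall i j j', 0 < (a i j).1 -> j < j' -> (a i j').1 = (a i j).1 ->
        (a i j).2 = false &
      forall i i' j, 0 < (a i j).1 -> i' < i -> (a i' j).1 = (a i j).1 ->
        (a i j).2 = true].

Definition plane_overpartitions (n : nat) : set (nat -> nat -> nat * bool) :=
  [set a | plane_overpartition n a].

Lemma plane_partition_box n a i j : plane_partition n a -> 0 < a i j ->
  [/\ i < n, j < n & a i j <= n].
Proof.
move=> [hr hc [N [h0 hs]]] ap.
have iN : i < N by rewrite ltnNge; apply/negP => h; rewrite h0 ?h in ap.
have jN : j < N by rewrite ltnNge; apply/negP => h; rewrite h0 ?h ?orbT in ap.
have H0 k : k < N -> \sum_(l < N) a k l <= n.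
  by move=> kN; rewrite -hs [leqRHS](bigD1 (Ordinal kN)) //= leq_addr.
split.
- apply: (@leq_trans (\sum_(k < N | k < i.+1) 1)).
    by rewrite -(big_ord_widen N (fun=> 1)) // sum1_card card_ord.
  rewrite -hs big_mkcond; apply: leq_sum => k _; case: ifP => // ki.
  rewrite [leqRHS](bigD1 (Ordinal jN)) //=; apply: leq_trans (leq_addr _ _).
  by apply: leq_trans ap _; apply: hc.
- apply: (@leq_trans (\sum_(k < N | k < j.+1) 1)).
    by rewrite -(big_ord_widen N (fun=> 1)) // sum1_card card_ord.
  apply: leq_trans (H0 i iN).
  rewrite big_mkcond; apply: leq_sum => k _; case: ifP => // kj.
  by apply: leq_trans ap _; apply: hr.
- by apply: leq_trans (H0 i iN); rewrite (bigD1 (Ordinal jN)) //= leq_addr.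
Qed.

(* Rules out the junk value 0 of the cardinal below. *)
Lemma finite_plane_overpartitions n : finite_set (plane_overpartitions n).
Proof.
pose pad (f : {ffun 'I_n * 'I_n -> 'I_n.+1 * bool}) (i j : nat) : nat * bool :=
  if (insub i, insub j) is (Some i', Some j')
  then (nat_of_ord (f (i', j')).1, (f (i', j')).2) else (0, false).
apply: (@sub_finite_set _ _ (pad @` setT)); last first.
  exact/finite_image/finite_finset.
move=> a [pa a0 _ _].
exists [ffun x : 'I_n * 'I_n => (inord (a x.1 x.2).1, (a x.1 x.2).2)] => //.
apply/funext => i; apply/funext => j; rewrite /pad.
have [ap|] := posnP (a i j).1; last first.
  move=> ap; have [iN jN vN] := plane_partition_box pa ap.
  by rewrite !insubT /= ffunE /= inordK ?ltnS //; case: (a i j).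
have -> : a i j = (0, false).
  by have := a0 _ _ ap; move: ap; case: (a i j) => /= ? ? -> ->.
case: insubP => // i' _ ei; case: insubP => // j' _ ej.
by rewrite ffunE /= ei ej ap a0 // inordK.
Qed.

Definition pl_over (n : nat) : nat := #|` fset_set (plane_overpartitions n)|%fset.

(* Main.v *)
Require Import Defs.
From mathcomp Require Import all_boot.
From mathcomp Require Import finmap zify.
From mathcomp Require Import boolp classical_sets cardinality.
Set Implicit Arguments.
Unset Strict Implicit.
Unset Printing Implicit Defensive.

(** Call a cell of a plane partition free if its positive entry does not occur
    again to its right or above it; these are the cells where both overlining
    choices are allowed.  Toggling the overline of a free cell is an
    involution, so the arrays with at least two free cells are counted by a
    multiple of 4.  If there is only one free cell, then all positive entries
    are equal to some [v], and the shape has no 2x2 block since the overlining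
    rules would conflict at its lower left corner; hence the shape is a hook of
    size [n / v].  There are [m] hooks of size [m], so the arrays with exactly
    one free cell number twice the sum of the divisors of [n]. *)

(** * Parity of the sum of divisors *)

Lemma sum_add_divisors p e (s : seq nat) :
  sumn (PrimeDecompAux.add_divisors (p, e) s) =
    (if odd p then e + 1 else 1) * sumn s %[mod 2].
Proof.
have merge_sum (t : seq nat) :
    sumn (merge leq [seq NatTrec.mul p i | i <- t] s) = p * sumn t + sumn s.
  rewrite (perm_sumn (permEl (perm_merge _ _ _))) sumn_cat; congr (_ + _).
  by elim: t => [|x t /= ->]; rewrite ?muln0 //= NatTrec.mulE mulnDr.
(* Each round of merging sends a sum [S] to [p * S + sumn s], so [e] rounds give
   [(1 + p + ... + p^e) * sumn s]; modulo 2 the factor is [e + 1] or 1. *)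
rewrite /=; elim: e => [|e IHe] /=; first by case: ifP; rewrite mul1n.
rewrite merge_sum -modnDml -modnMmr IHe modnMmr modnDml.
rewrite !modn2 !(oddD, oddM); case: ifP => op; rewrite ?oddD /=;
  by case: (odd e); case: (odd (sumn s)).
Qed.

(** [divisors n] is built by folding [add_divisors] over the prime decomposition, so each prime
    contributes one factor. *)
Lemma sum_divisors_mod2 n :
  \sum_(d <- divisors n) d =
    \prod_(p <- primes n | odd p) (logn p n + 1) %[mod 2].
Proof.
rewrite -sumnE /divisors prime_decompE.
elim: (primes n) => [|p s IHs]; first by rewrite big_nil.
rewrite [foldr _ _ _]/= sum_add_divisors -modnMmr IHs modnMmr big_cons.
by case: ifP => _; rewrite ?mul1n.
Qed.

(** * Counting with involutions *)

Section Fsets.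
Local Open Scope fset_scope.
Context {K : choiceType}.
Implicit Types (A : {fset K}) (P : pred K).

Lemma card_fset_split A P :
  #|` A| = (#|` [fset x in A | P x]| + #|` [fset x in A | ~~ P x]|)%N.
Proof.
rewrite -(cardfsID [fset x in A | P x] A); congr addn;
  congr (#|` _|); apply/fsetP => x; rewrite !inE /=.
  by case: (x \in A).
by case: (x \in A); rewrite ?andbF ?andbT.
Qed.

(** [f] exchanges the part where [P] holds with the part where it fails. *)
Lemma card_fset_involution A P (f : K -> K) :
    {in A, forall x, f x \in A} -> {in A, forall x, f (f x) = x} ->
    {in A, forall x, P (f x) = ~~ P x} ->
  #|` A| = 2 * #|` [fset x in A | P x]|.
Proof.
move=> fA ff Pf; rewrite (card_fset_split A P) mul2n -addnn; congr addn.
have -> : [fset x in A | ~~ P x] = f @` [fset x in A | P x].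
  apply/fsetP => x; rewrite !inE /=; apply/andP/imfsetP => /=.
    by move=> [xA Px]; exists (f x); rewrite ?ff // !inE /= fA ?Pf.
  by move=> [y]; rewrite !inE /= => /andP[yA Py] ->; rewrite fA // Pf // Py.
rewrite card_in_imfset //= => x y; rewrite !inE /= => /andP[xA _] /andP[yA _] e.
by rewrite -(ff x) // e ff.
Qed.

End Fsets.

(** * Free cells and toggling their overlines *)

Section FreeCells.
Implicit Types (n : nat) (a : nat -> nat -> nat * bool) (c : nat * nat).

Definition entries a i j : nat := (a i j).1.

Definition free_cell (p : nat -> nat -> nat) c : Prop :=
  [/\ 0 < p c.1 c.2,
      forall j, c.2 < j -> p c.1 j <> p c.1 c.2 &
      forall i, i < c.1 -> p i c.2 <> p c.1 c.2].

Definition toggle c a i j : nat * bool :=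
  if (i, j) == c then ((a i j).1, ~~ (a i j).2) else a i j.

Lemma entries_toggle c a : entries (toggle c a) = entries a.
Proof.
apply/funext => i; apply/funext => j; rewrite /entries /toggle.
by case: ifP.
Qed.

Lemma toggleE1 c a i j : (toggle c a i j).1 = (a i j).1.
Proof. by rewrite /toggle; case: ifP. Qed.

Lemma toggleK c : involutive (toggle c).
Proof.
move=> a; apply/funext => i; apply/funext => j; rewrite /toggle.
by case: eqP => //= _; rewrite negbK; case: (a i j).
Qed.

(** At a free cell the premises of both overlining rules fail, so neither rule constrains its
    overline. *)
Lemma plane_overpartition_toggle n c a : free_cell (entries a) c ->
  plane_overpartition n a -> plane_overpartition n (toggle c a).
Proof.
case: c => ci cj [/= cp cr cc] [pa a0 ar ac]; split.
- by rewrite -/(entries (toggle (ci, cj) a)) entries_toggle.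
- move=> i j; rewrite toggleE1 /toggle => h; case: eqP => [[ei ej]|_]; last exact: a0.
  by move: cp; rewrite /entries -ei -ej h.
- move=> i j j'; rewrite !toggleE1 /toggle => h1 h2 h3.
  case: eqP => [[ei ej]|_]; last exact: ar h1 h2 h3.
  by subst; case: (cr _ h2).
- move=> i i' j; rewrite !toggleE1 /toggle => h1 h2 h3.
  case: eqP => [[ei ej]|_]; last exact: ac h1 h2 h3.
  by subst; case: (cc _ h2).
Qed.

Lemma last_occurrence (u : nat -> nat) N j : (forall k, N <= k -> u k = 0) ->
  0 < u j -> exists2 k, j <= k & u k = u j /\ forall l, k < l -> u l <> u j.
Proof.
move=> u0 uj.
have exP : exists k, u k == u j by exists j.
have ubP k : u k == u j -> k <= N.
  by move=> /eqP e; rewrite leqNgt; apply/negP => /ltnW /u0 e0; move: uj; rewrite -e e0.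
case: (ex_maxnP exP ubP) => k /eqP ek kmax; exists k; first exact: kmax.
by split => // l kl /eqP /kmax; rewrite leqNgt kl.
Qed.

Lemma plane_partition_last_in_row n p i j : plane_partition n p -> 0 < p i j ->
  exists2 k, j <= k & p i k = p i j /\ forall l, k < l -> p i l <> p i j.
Proof.
move=> [_ _ [N [p0 _]]]; apply: (@last_occurrence _ N) => k Nk.
by apply: p0; rewrite Nk orbT.
Qed.

Lemma plane_partition_last_in_column n p i j : plane_partition n p -> 0 < p i j ->
  exists2 k, i <= k & p k j = p i j /\ forall l, k < l -> p l j <> p i j.
Proof.
move=> [_ _ [N [p0 _]]]; apply: (@last_occurrence (p^~ j) N) => k Nk.
by apply: p0; rewrite Nk.
Qed.

Lemma plane_partition_corner_gt0 n p : 0 < n -> plane_partition n p -> 0 < p 0 0.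
Proof.
move=> n0 [pr pc [N [p0 ps]]]; rewrite lt0n; apply/negP => /eqP p00.
move: n0; rewrite -ps big1 // => i _; rewrite big1 // => j _; apply/eqP.
by rewrite -leqn0 -p00; apply: (leq_trans (pr _ 0 _ _)) => //; apply: pc.
Qed.

Lemma exists_free_cell n p : 0 < n -> plane_partition n p ->
  exists c, free_cell p c.
Proof.
move=> n0 pp; have p00 := plane_partition_corner_gt0 n0 pp.
have [k _ [ek kl]] := plane_partition_last_in_row pp p00.
(* The last occurrence of the corner entry in row 0 is free, since no cell lies above it. *)
by exists (0, k); split => //=; rewrite ek.
Qed.

(** In the first row with a positive entry other than [p 0 0], the last occurrence of that entry is
    free: the cells above hold only [p 0 0] or 0. It would be a second free cell besides the one in
    row 0. *)
Lemma unique_free_cell_constant n p c : 0 < n -> plane_partition n p ->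
    (forall d, free_cell p d -> d = c) ->
  forall i j, p i j = p 0 0 \/ p i j = 0.
Proof.
move=> n0 pp uc; have p00 := plane_partition_corner_gt0 n0 pp.
have [k _ [ek kl]] := plane_partition_last_in_row pp p00.
elim/ltn_ind => i IHi j; have [|pij] := posnP (p i j); first by right.
left; have [l _ [el ll]] := plane_partition_last_in_row pp pij.
apply: contrapT => ne.
suff /uc e : free_cell p (i, l).
  suff /uc : free_cell p (0, k) by rewrite -e => -[e1 e2]; apply: ne; rewrite -el -e1 -e2.
  by split => //=; rewrite ek.
split => /=; rewrite ?el // => i' /IHi /(_ l)[->|->] h; [exact: ne|].
by move: pij; rewrite -h.
Qed.

End FreeCells.

(** * Constant hook-shaped arrays *)

Section Hooks.
Implicit Types (n v L M : nat).

(** Arm and leg exclude the corner, so the hook has [(L + M).+1] cells. *)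
Definition in_hook L M i j := ((i == 0) && (j <= L)) || ((j == 0) && (i <= M)).

(* The constant hook with arm [L] and leg [M] whose free cell [(0, L)] is overlined. *)
Definition hook v L M i j : nat * bool :=
  if in_hook L M i j then (v, (0 < i) || (j == L)) else (0, false).

Lemma entries_hook v L M i j :
  entries (hook v L M) i j = if in_hook L M i j then v else 0.
Proof. by rewrite /entries /hook; case: ifP. Qed.

Lemma sum_hook v L M N : L < N -> M < N ->
  \sum_(i < N) \sum_(j < N) (if in_hook L M i j then v else 0) = v * (L + M).+1.
Proof.
have sum_le K N' : K < N' -> \sum_(i < N') (if i <= K then v else 0) = v * K.+1.
  move=> KN; transitivity (\sum_(i < K.+1) v).
    by rewrite (big_ord_widen N' (fun=> v) KN) [RHS]big_mkcond.
  by rewrite sum_nat_const card_ord mulnC.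
case: N => // N LN MN; rewrite big_ord_recl /=.
rewrite (eq_bigr (fun j : 'I_N.+1 => if j <= L then v else 0)); last first.
  by move=> j _; rewrite /in_hook /= andbT; case: (j : nat) => [|?]; rewrite ?orbF.
rewrite sum_le //; set S := (X in _ + X).
(* [S] sums the rows below row 0; adding the corner completes column 0. *)
suff : S + v = v * M.+1 by lia.
rewrite -(sum_le M N.+1) // big_ord_recl /= addnC; congr (_ + _).
apply: eq_bigr => i _; rewrite big_ord_recl big1 ?addn0 //.
Qed.

Lemma plane_overpartition_hook v L M : 0 < v ->
  plane_overpartition (v * (L + M).+1) (hook v L M).
Proof.
move=> v0; split.
- split.
  + move=> i j j' jj'; rewrite -!/(entries _ _ _) !entries_hook.
    by rewrite /in_hook; do 2 case: ifP => //; lia.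
  + move=> i j j' jj'; rewrite -!/(entries _ _ _) !entries_hook.
    by rewrite /in_hook; do 2 case: ifP => //; lia.
  + exists (L + M).+1; split.
      by move=> i j; rewrite -/(entries _ _ _) entries_hook /in_hook; case: ifP => //; lia.
    rewrite -(@sum_hook v L M (L + M).+1); [|lia..].
    by do 2 apply: eq_bigr => ? _; rewrite -entries_hook.
- by move=> i j; rewrite /hook; case: ifP => //= _; lia.
- by move=> i j j'; rewrite /hook /in_hook; do 2 case: ifP => //=; lia.
- by move=> i i' j; rewrite /hook /in_hook; do 2 case: ifP => //=; lia.
Qed.

Lemma free_cell_hook v L M c : 0 < v -> free_cell (entries (hook v L M)) c <-> c = (0, L).
Proof.
case: c => i j v0; split; rewrite /free_cell /=.
  rewrite !entries_hook => -[h1 h2 h3].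
  suff [-> ->] : i = 0 /\ j = L by [].
  (* Two neighbours suffice: an arm cell before the end repeats just to its right, a leg cell just
     above. *)
  have := h2 j.+1 (ltnSn j); have := h3 i.-1; rewrite !entries_hook.
  move: h1; rewrite /in_hook; case: ifP => // ij _.
  by do 2 case: ifP; lia.
move=> [-> ->]; rewrite !entries_hook /in_hook leqnn eqxx /=; split => // k kL.
by rewrite entries_hook /in_hook; case: ifP => //; lia.
Qed.

Lemma hook_inj v L M v' L' M' : 0 < v -> hook v L M = hook v' L' M' ->
  [/\ v = v', L = L' & M = M'].
Proof.
move=> v0 e.
have e' i j := congr1 (fun f => entries f i j) e.
have /= := e' 0 0; rewrite !entries_hook /in_hook /= => vv'; subst v'; split=> //.
- have := e' 0 L; have := e' 0 L'; rewrite !entries_hook /in_hook /= !leqnn /=.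
  by do 2 case: ifP; lia.
- have := e' M 0; have := e' M' 0; rewrite !entries_hook /in_hook /= !leqnn !orbT /=.
  by do 2 case: ifP; lia.
Qed.

(** The entries form a constant hook, and the overlining rules force every overline except the one
    at the free cell, which is assumed. *)
Lemma unique_free_cell_hook n a c : 0 < n -> plane_overpartition n a ->
    free_cell (entries a) c -> (forall d, free_cell (entries a) d -> d = c) ->
    (a c.1 c.2).2 ->
  exists v L M, [/\ 0 < v, n = v * (L + M).+1 & a = hook v L M].
Proof.
move=> n0 [pa a0 ar ac] fc uc oc.
have cst := unique_free_cell_constant n0 pa uc.
have v0 := plane_partition_corner_gt0 n0 pa.
have [L _ [eL hL]] := plane_partition_last_in_row pa v0.
have [M _ [eM hM]] := plane_partition_last_in_column pa v0.
have ec : c = (0, L) by apply/esym/uc; split => //=; rewrite /entries eL.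
have [pr pc _] := pa.
set v := (a 0 0).1 in v0 cst eL hL eM hM *.
have row0 j : (a 0 j).1 = if j <= L then v else 0.
  case: leqP => [jL|/hL ne]; last by case: (cst 0 j).
  by apply/eqP; rewrite eqn_leq /v pr // -/v -eL pr.
have col0 i : (a i 0).1 = if i <= M then v else 0.
  case: leqP => [iM|/hM ne]; last by case: (cst i 0).
  by apply/eqP; rewrite eqn_leq /v pc // -/v -eM pc.
have a11 : (a 1 1).1 = 0.
  case: (cst 1 1) => // e11; rewrite /entries -/v in e11.
  have e10 : (a 1 0).1 = v.
    by apply/eqP; rewrite eqn_leq {1}/v pc //= -e11 pr.
  have := ar 1 0 1; rewrite e10 e11 => /(_ v0 isT erefl).
  by rewrite (ac 1 0 0) // e10.
have aij i j : (a i j).1 = if in_hook L M i j then v else 0.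
  rewrite /in_hook; case: i => [|i]; first by rewrite row0 /=; case: j => [|j]; rewrite ?orbF.
  case: j => [|j]; first by rewrite col0.
  apply/eqP; rewrite /= -leqn0 -a11.
  (* Every cell off row 0 and column 0 is bounded by the entry at [(1, 1)]. *)
  by apply: (leq_trans (pr _ 1 _ _)) => //; apply: pc.
exists v, L, M; split => //.
  have [_ _ [N [z s]]] := pa.
  have LN : L < N.
    by rewrite ltnNge; apply/negP => NL; move: v0; rewrite -eL z // NL orbT.
  have MN : M < N by rewrite ltnNge; apply/negP => NM; move: v0; rewrite -eM z // NM.
  rewrite -s -(sum_hook v LN MN).
  by do 2 apply: eq_bigr => ? _; rewrite aij.
apply/funext => i; apply/funext => j; rewrite [LHS]surjective_pairing aij /hook.
case: ifP => ij; last by rewrite a0 // aij ij.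
(* Arm cells before the end repeat to the right, hence are plain; leg cells repeat above, hence are
   overlined. *)
congr (_, _); move: ij; rewrite /in_hook; case: (posnP i) => [-> /=|i0].
  case: (eqVneq j L) => [-> _|jL h]; first by rewrite ec in oc.
  have {h}jL' : j < L by lia.
  by apply: (ar 0 j j.+1); rewrite // !row0 ?jL' (ltnW jL').
rewrite /= => /andP[/eqP -> iM].
by apply: (ac i 0 0); rewrite // !col0 ?iM.
Qed.

End Hooks.

(** * Counting by the number of free cells *)

Section Counting.
Local Open Scope fset_scope.
Variable n : nat.
Hypothesis n_gt0 : 0 < n.

Let A := fset_set (plane_overpartitions n).

(** The choice depends on the entries alone, so toggling does not change it; this makes toggling at
    the chosen cell an involution. *)
Definition cell1 (p : nat -> nat -> nat) : nat * nat := xget (0, 0) (free_cell p).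
Definition other_free_cell p c := free_cell p c /\ c <> cell1 p.
Definition cell2 (p : nat -> nat -> nat) : nat * nat := xget (0, 0) (other_free_cell p).

Let over1 (a : nat -> nat -> nat * bool) := (a (cell1 (entries a)).1 (cell1 (entries a)).2).2.
Let over2 (a : nat -> nat -> nat * bool) := (a (cell2 (entries a)).1 (cell2 (entries a)).2).2.
Let many (a : nat -> nat -> nat * bool) := `[< exists c, other_free_cell (entries a) c >].

Let memA a : (a \in A) = `[< plane_overpartition n a >].
Proof.
rewrite (in_fset_set (finite_plane_overpartitions n)).
by apply/idP/asboolP; rewrite inE.
Qed.

Let cell1P a : a \in A -> free_cell (entries a) (cell1 (entries a)).
Proof.
rewrite memA => /asboolP[pa _ _ _]; apply: xgetPex.
exact: exists_free_cell n_gt0 pa.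
Qed.

Let cell2P a : many a -> other_free_cell (entries a) (cell2 (entries a)).
Proof. by move=> /asboolP h; apply: xgetPex. Qed.

Let toggleA a c : a \in A -> free_cell (entries a) c -> toggle c a \in A.
Proof.
rewrite !memA => /asboolP pa fc; apply/asboolP.
exact: plane_overpartition_toggle.
Qed.

(** Toggling [cell1] halves the set, and toggling [cell2] halves it again. *)
Lemma card_many_free_cells : 4 %| #|` [fset a in A | many a]|.
Proof.
rewrite (@card_fset_involution _ _ over1 (fun a => toggle (cell1 (entries a)) a)).
- rewrite (@card_fset_involution _ _ over2 (fun a => toggle (cell2 (entries a)) a)).
  + by rewrite mulnA dvdn_mulr.
  + move=> a; rewrite !inE /= => /andP[/andP[aA ma] oa].
    have [f2 ne] := cell2P ma.
    rewrite toggleA // /many /over1 entries_toggle -/(many a) ma /=.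
    (* As [cell2] differs from [cell1], the second toggle preserves the overline at [cell1]. *)
    by rewrite /toggle -surjective_pairing; case: eqP => // /esym.
  + by move=> a _ /=; rewrite entries_toggle toggleK.
  + by move=> a _; rewrite /over2 entries_toggle /toggle -surjective_pairing eqxx.
- move=> a; rewrite !inE /= => /andP[aA ma].
  by rewrite (toggleA aA (cell1P aA)) /many entries_toggle.
- by move=> a _ /=; rewrite entries_toggle toggleK.
- by move=> a _; rewrite /over1 entries_toggle /toggle -surjective_pairing eqxx.
Qed.

(** Here [m] is the number of cells, [k] the arm and [m.-1 - k] the leg; the entry [n %/ m] makes
    the total [n]. *)
Let hooks := [seq hook (n %/ m) k (m.-1 - k) | m <- divisors n, k <- iota 0 m].

Let quotient_gt0 m : m \in divisors n -> 0 < n %/ m.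
Proof.
rewrite -dvdn_divisors // => mn.
by rewrite divn_gt0 ?(dvdn_gt0 n_gt0) // dvdn_leq.
Qed.

Lemma uniq_hooks : uniq hooks.
Proof.
apply: allpairs_uniq_dep => [|m _|]; [exact: divisors_uniq|exact: iota_uniq|].
move=> _ _ /allpairsPdep[m [k [mn km ->]]] /allpairsPdep[m' [k' [mn' km' ->]]] /=.
move=> /(hook_inj (quotient_gt0 mn))[em ek el]; subst k'.
rewrite !mem_iota /= !add0n in km km'.
(* Since [k] is below both [m] and [m'], the subtractions are not truncated, and arm and leg
   determine the size. *)
suff -> : m = m' by [].
by lia.
Qed.

Lemma single_free_cell_hooks : [fset a in A | ~~ many a & over1 a] =i hooks.
Proof.
move=> a; rewrite !inE /=; apply/andP/allpairsPdep.
  move=> [aA /andP[ma oa]].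
  have uc d : free_cell (entries a) d -> d = cell1 (entries a).
    by move=> fd; apply: contrapT => ne; move/asboolP: ma; apply; exists d.
  have fc := cell1P aA; move: aA; rewrite memA => /asboolP pa.
  have [v [L [M [v0 en ea]]]] := unique_free_cell_hook n_gt0 pa fc uc oa.
  exists (L + M).+1, L; split.
  - by rewrite -dvdn_divisors // en dvdn_mull.
  - by rewrite mem_iota; lia.
  - by rewrite ea en mulnK //= addKn.
move=> [m [k [mn]]]; rewrite mem_iota /= add0n => km ->.
have v0 := quotient_gt0 mn.
have hA : hook (n %/ m) k (m.-1 - k) \in A.
  rewrite memA; apply/asboolP; have := plane_overpartition_hook k (m.-1 - k) v0.
  have -> : (k + (m.-1 - k)).+1 = m by lia.
  by rewrite divnK // dvdn_divisors.
have c1 := (free_cell_hook _ _ _ v0).1 (cell1P hA).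
split=> //; apply/andP; split.
  by apply/asboolP => -[c []]; rewrite c1 => /(free_cell_hook _ _ _ v0).
by rewrite /over1 c1 /hook /in_hook leqnn /= eqxx.
Qed.

Lemma card_single_free_cell :
  #|` [fset a in A | ~~ many a]| = 2 * \sum_(d <- divisors n) d.
Proof.
rewrite (@card_fset_involution _ _ over1 (fun a => toggle (cell1 (entries a)) a)).
- congr (_ * _).
  have -> : [fset a in [fset a in A | ~~ many a] | over1 a] = [fset a in hooks].
    apply/fsetP => a; transitivity (a \in hooks); last by rewrite !inE.
    by rewrite -single_free_cell_hooks !inE /= andbA.
  rewrite card_fseq undup_id ?uniq_hooks // size_allpairs_dep.
  (* Each divisor [m] contributes [m] hooks, one for each arm. *)
  by rewrite sumnE big_map; apply: eq_bigr => m _; rewrite size_iota.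
- move=> a; rewrite !inE /= => /andP[aA ma].
  by rewrite (toggleA aA (cell1P aA)) /many entries_toggle.
- by move=> a _ /=; rewrite entries_toggle toggleK.
- by move=> a _; rewrite /over1 entries_toggle /toggle -surjective_pairing eqxx.
Qed.

Lemma pl_over_mod4 : pl_over n = 2 * \sum_(d <- divisors n) d %[mod 4].
Proof.
rewrite /pl_over -/A (card_fset_split A many) card_single_free_cell.
by rewrite -modnDml (eqP card_many_free_cells).
Qed.

End Counting.

Theorem theorem1p4 (n : nat) (hn : 1 < n) :
  pl_over n = 2 * \prod_(p <- primes n | odd p) (logn p n + 1) %[mod 4].
Proof.
(* Cancelling the common factor 2 leaves a congruence modulo 2. *)
rewrite pl_over_mod4 1?ltnW // -[4]/(2 * 2) -!muln_modr //.
by rewrite sum_divisors_mod2.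
Qed.
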